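(* Let $(M,g)$ be a Hopf hypersurface of a Kaehler-like statistical manifold. Then $\xi^{\ast}$ is a geodesic vector field with respect to $\nabla^{\ast}$ if and only if $\theta(\xi^{\ast})=0$.
   Context: Hermite-like statistical manifold: a semi-Riemannian manifold $(\widetilde M,\widetilde g)$ with two almost complex structures $J,J^{\ast}$ ($J^2=(J^{\ast})^2=-I$) satisfying $\widetilde g(JX,Y)=-\widetilde g(X,J^{\ast}Y)$ for all vector fields $X,Y$, and an affine connection $\widetilde\nabla$ such that $\widetilde\nabla\widetilde g$ is symmetric. The dual connection $\widetilde\nabla^{\ast}$ is defined by $Z\,\widetilde g(X,Y)=\widetilde g(\widetilde\nabla_ZX,Y)+\widetilde g(X,\widetilde\nabla^{\ast}_ZY)$, and $\frac12(\widetilde\nabla+\widetilde\nabla^{\ast})$ is the Levi-Civita connection of $\widetilde g$. It is Kaehler-like if $\widetilde\nabla J=0$ (then also $\widetilde\nabla^{\ast}J^{\ast}=0$). Tangential hypersurface: a non-degenerate hypersurface $(M,g)$, $g$ the induced metric, with unit normal field $N$, such that $JN$ and $J^{\ast}N$ are tangent to $M$. Put $\xi=-JN$, $\xi^{\ast}=-J^{\ast}N$, $\varepsilon=g(\xi,\xi^{\ast})$. Gauss and Weingarten formulas, for $X,Y$ tangent to $M$: $\widetilde\nabla_XY=\nabla_XY+\varepsilon g(A^{\ast}_NX,Y)N$, $\ \widetilde\nabla_XN=-A_NX+\varepsilon\theta(X)N$, $\widetilde\nabla^{\ast}_XY=\nabla^{\ast}_XY+\varepsilon g(A_NX,Y)N$,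 $\ \widetilde\nabla^{\ast}_XN=-A^{\ast}_NX-\varepsilon\theta(X)N$, where $\nabla,\nabla^{\ast}$ are the induced connections on $M$, $A_N,A_N^{\ast}$ the shape operators and $\theta$ a 1-form on $M$. Hopf hypersurface: a tangential hypersurface for which there are smooth functions $\rho,\rho^{\ast}$ with $A_N\xi=\rho\xi$ and $A^{\ast}_N\xi^{\ast}=\rho^{\ast}\xi^{\ast}$. A vector field $X$ is called geodesic with respect to a connection $D$ if there is a smooth function $\zeta$ with $D_XX=\zeta X$; if $\zeta=0$, $X$ is called a unit geodesic vector field.
   Formalization: ''Geodesic'' is replaced by ''unit geodesic'' (ζ = 0, i.e. ∇*_{ξ*}ξ* = 0): with an arbitrary smooth ζ, ξ* is always geodesic on such hypersurfaces, since ∇*_{ξ*}ξ* = −εθ(ξ* )ξ*, while θ(ξ* ) need not vanish, so the literal equivalence is false. *)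

(* Defs.v *)
From HB Require Import structures.
From mathcomp Require Import all_boot all_order all_algebra.
From mathcomp Require Import all_classical all_reals all_analysis.

Set Implicit Arguments.
Unset Strict Implicit.
Unset Printing Implicit Defensive.
Import Order.TTheory GRing.Theory Num.Theory numFieldNormedType.Exports.
Local Open Scope classical_set_scope.
Local Open Scope ring_scope.

(** * Smooth functions on open subsets of R^n *)

Fixpoint Ck (R : realType) (n k : nat) (U : set 'rV[R]_n)
    (f : 'rV[R]_n -> R) : Prop :=
  match k with
  | 0 => forall x, U x -> {for x, continuous f}
  | k'.+1 => (forall x, U x -> differentiable f x) /\
             (forall v, Ck k' U (fun x => 'D_v f x))
  end.

Definition smooth_on (R : realType) (n : nat) (U : set 'rV[R]_n)
    (f : 'rV[R]_n -> R) : Prop :=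
  forall k, Ck k U f.

(** * Manifolds *)

(* [cmap] and [cinv] are total functions; only their values on [cdom] and on
   the image of [cdom] are meaningful. *)
Record chart (R : realType) (n : nat) (T : topologicalType) := Chart {
  cdom : set T;
  cmap : T -> 'rV[R]_n;
  cinv : 'rV[R]_n -> T;
  cdom_open : open cdom;
  cimg_open : open (cmap @` cdom);
  cmapK : forall p, cdom p -> cinv (cmap p) = p;
  cmap_cont : forall p, cdom p -> {for p, continuous cmap};
  cinv_cont : forall y, (cmap @` cdom) y -> {for y, continuous cinv} }.

(* [atlas] need not be maximal. *)
Record manifold (R : realType) (n : nat) := Manifold {
  carrier :> topologicalType;
  carrier_hausdorff : hausdorff_space carrier;
  carrier_second_countable : @second_countable carrier;
  atlas : set (chart R n carrier);
  atlas_cover : forall p, exists2 c, atlas c & cdom c p;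
  atlas_compatible : forall c c', atlas c -> atlas c' -> forall j,
    smooth_on (cmap c @` (cdom c `&` cdom c'))
              (fun y => cmap c' (cinv c y) 0 j) }.

Definition smooth_fun (R : realType) (n : nat) (M : manifold R n)
    (f : M -> R) : Prop :=
  forall c, atlas c -> smooth_on (cmap c @` cdom c) (f \o cinv c).

Definition smooth_map (R : realType) (m n : nat) (M : manifold R m)
    (M' : manifold R n) (f : M -> M') : Prop :=
  continuous f /\
  forall c c', atlas c -> atlas c' -> forall j,
    smooth_on (cmap c @` (cdom c `&` f @^-1` cdom c'))
              (fun y => cmap c' (f (cinv c y)) 0 j).

(** * Tangent vectors and vector fields *)

(* Tangent vectors are directional derivatives of smooth functions.  They are
   represented as functionals on all functions, with value 0 on the non-smooth
   ones, so that vectors are added, scaled and compared as functionals; the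
   tangent space at [p] is the subspace [tangent p] of [tvec R M]. *)
Notation tvec R M := ((M -> R) -> R).
Notation tfield R M := (M -> tvec R M).
Notation tform R M := (M -> tvec R M -> R).
Notation tbilin R M := (M -> tvec R M -> tvec R M -> R).
Notation tendo R M := (M -> tvec R M -> tvec R M).
(* Operators D X V on fields X on [M] and fields V along a map from [M] to
   [M'] (on [M] itself for [conn R M]). *)
Notation conn_op R M M' := (tfield R M -> (M -> tvec R M') -> M -> tvec R M').
Notation conn R M := (conn_op R M M).

Definition tangent (R : realType) (n : nat) (M : manifold R n) (p : M)
    (v : tvec R M) : Prop :=
  exists c a, [/\ atlas c, cdom c p &
    v = fun h => if `[< smooth_fun h >] then 'D_a (h \o cinv c) (cmap c p)
                 else 0].

Definition dmap (R : realType) (m n : nat) (M : manifold R m)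
    (M' : manifold R n) (f : M -> M') (v : tvec R M) : tvec R M' :=
  fun h => if `[< smooth_fun h >] then v (h \o f) else 0.

(* Sections of the pullback of the tangent bundle of [M'] along [f]. *)
Definition field_along (R : realType) (m n : nat) (M : manifold R m)
    (M' : manifold R n) (f : M -> M') (V : M -> tvec R M') : Prop :=
  (forall p, tangent (f p) (V p)) /\
  (forall h, smooth_fun h -> smooth_fun (fun p => V p h)).

Definition vector_field (R : realType) (n : nat) (M : manifold R n)
    (X : tfield R M) : Prop :=
  field_along idfun X.

(** * Tensors *)

Record one_form (R : realType) (n : nat) (M : manifold R n)
    (theta : tform R M) : Prop := OneForm {
  one_form_lin : forall p a u v, tangent p u -> tangent p v ->
    theta p (a *: u + v) = a * theta p u + theta p v;
  one_form_smooth : forall X, vector_field X ->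
    smooth_fun (fun p => theta p (X p)) }.

Record endo_field (R : realType) (n : nat) (M : manifold R n)
    (A : tendo R M) : Prop := EndoField {
  endo_tangent : forall p u, tangent p u -> tangent p (A p u);
  endo_lin : forall p a u v, tangent p u -> tangent p v ->
    A p (a *: u + v) = a *: A p u + A p v;
  endo_smooth : forall X, vector_field X -> vector_field (fun p => A p (X p)) }.

Definition nondegenerate (R : realType) (n : nat) (M : manifold R n)
    (g : tbilin R M) : Prop :=
  forall p u, tangent p u -> (forall v, tangent p v -> g p u v = 0) -> u = 0.

Record semi_riemannian (R : realType) (n : nat) (M : manifold R n)
    (g : tbilin R M) : Prop := SemiRiemannian {
  metric_lin : forall p a u v w, tangent p u -> tangent p v -> tangent p w ->
    g p (a *: u + v) w = a * g p u w + g p v w;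
  metric_sym : forall p u v, tangent p u -> tangent p v -> g p u v = g p v u;
  metric_nondegenerate : nondegenerate g;
  metric_smooth : forall X Y, vector_field X -> vector_field Y ->
    smooth_fun (fun p => g p (X p) (Y p)) }.

Definition almost_complex (R : realType) (n : nat) (M : manifold R n)
    (J : tendo R M) : Prop :=
  endo_field J /\ forall p u, tangent p u -> J p (J p u) = - u.

(** * Connections *)

(* Covariant differentiation, in the direction of vector fields on [M], of
   vector fields along [f : M -> M']. *)
Record connection_along (R : realType) (m n : nat) (M : manifold R m)
    (M' : manifold R n) (f : M -> M')
    (D : conn_op R M M') : Prop := ConnectionAlong {
  conn_field : forall X V, vector_field X -> field_along f V ->
    field_along f (D X V);
  conn_lin : forall a X Y V, smooth_fun a -> vector_field X ->
    vector_field Y -> field_along f V -> forall p,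
    D (fun q => a q *: X q + Y q) V p = a p *: D X V p + D Y V p;
  conn_add : forall X V W, vector_field X -> field_along f V ->
    field_along f W -> forall p,
    D X (fun q => V q + W q) p = D X V p + D X W p;
  conn_leibniz : forall a X V, smooth_fun a -> vector_field X ->
    field_along f V -> forall p,
    D X (fun q => a q *: V q) p = X p a *: V p + a p *: D X V p }.

Definition affine_connection (R : realType) (n : nat) (M : manifold R n)
    (D : conn R M) : Prop :=
  connection_along idfun D.

(* [D] is the (unique) connection along [f] extending [nabla]: this is the
   meaning of "nabla_X V" when [X] is a vector field on [M] and [V] is only
   defined along [f]. *)
Definition pullback_connection (R : realType) (m n : nat) (M : manifold R m)
    (M' : manifold R n) (f : M -> M') (nabla : conn R M')
    (D : conn_op R M M') : Prop :=
  connection_along f D /\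
  forall X Z Y, vector_field X -> vector_field Z -> vector_field Y ->
  forall p, Z (f p) = dmap f (X p) ->
    D X (fun q => Y (f q)) p = nabla Z Y (f p).

Definition lie_bracket (R : realType) (n : nat) (M : manifold R n)
    (X Y : tfield R M) (p : M) : tvec R M :=
  fun h => X p (fun q => Y q h) - Y p (fun q => X q h).

Definition torsion_free (R : realType) (n : nat) (M : manifold R n)
    (D : conn R M) : Prop :=
  forall X Y, vector_field X -> vector_field Y -> forall p,
    D X Y p - D Y X p = lie_bracket X Y p.

Definition dual_connections (R : realType) (n : nat) (M : manifold R n)
    (g : tbilin R M) (D Ds : conn R M) : Prop :=
  forall X Y Z, vector_field X -> vector_field Y -> vector_field Z ->
  forall p, Z p (fun q => g q (X q) (Y q)) =
            g p (D Z X p) (Y p) + g p (X p) (Ds Z Y p).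

Definition levi_civita (R : realType) (n : nat) (M : manifold R n)
    (g : tbilin R M) (D : conn R M) : Prop :=
  [/\ affine_connection D, torsion_free D & dual_connections g D D].

Definition nabla_metric (R : realType) (n : nat) (M : manifold R n)
    (g : tbilin R M) (D : conn R M) (X Y Z : tfield R M) (p : M) : R :=
  X p (fun q => g q (Y q) (Z q)) - g p (D X Y p) (Z p) - g p (Y p) (D X Z p).

(** * Hermite-like and Kaehler-like statistical manifolds *)

Record hermite_like (R : realType) (n : nat) (M : manifold R n)
    (g : tbilin R M) (J Js : tendo R M)
    (nabla nablas : conn R M) : Prop := HermiteLike {
  hl_metric : semi_riemannian g;
  hl_J : almost_complex J;
  hl_Js : almost_complex Js;
  hl_JJs : forall X Y, vector_field X -> vector_field Y -> forall p,
    g p (J p (X p)) (Y p) = - g p (X p) (Js p (Y p));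
  hl_conn : affine_connection nabla;
  hl_sym : forall X Y Z, vector_field X -> vector_field Y -> vector_field Z ->
    forall p, nabla_metric g nabla X Y Z p = nabla_metric g nabla Y X Z p;
  hl_dual_conn : affine_connection nablas;
  hl_dual : dual_connections g nabla nablas;
  hl_levi_civita :
    levi_civita g (fun X Y p => 2^-1 *: (nabla X Y p + nablas X Y p)) }.

Definition kaehler_like (R : realType) (n : nat) (M : manifold R n)
    (g : tbilin R M) (J Js : tendo R M) (nabla nablas : conn R M) : Prop :=
  hermite_like g J Js nabla nablas /\
  forall X Y, vector_field X -> vector_field Y -> forall p,
    nabla X (fun q => J q (Y q)) p = J p (nabla X Y p).

(** * Hypersurfaces *)

Definition induced_metric (R : realType) (m n : nat) (M : manifold R m)
    (M' : manifold R n) (i : M -> M') (g : tbilin R M')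
    (p : M) (u v : tvec R M) : R :=
  g (i p) (dmap i u) (dmap i v).

(* [xi] and [xis] are -JN and -J*N, seen as vector fields on [M]; their
   existence is the tangency of JN and J*N. *)
Record tangential_hypersurface (R : realType) (n : nat) (M : manifold R n)
    (M' : manifold R n.+1) (i : M -> M') (g : tbilin R M') (J Js : tendo R M')
    (N : M -> tvec R M') (xi xis : tfield R M)
    : Prop := TangentialHypersurface {
  th_smooth : smooth_map i;
  th_immersion : forall p u v, tangent p u -> tangent p v ->
    dmap i u = dmap i v -> u = v;
  th_nondegenerate : nondegenerate (induced_metric i g);
  th_N : field_along i N;
  th_normal : forall p u, tangent p u -> g (i p) (N p) (dmap i u) = 0;
  th_unit : forall p, `|g (i p) (N p) (N p)| = 1;
  th_xi : vector_field xi;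
  th_xis : vector_field xis;
  th_xiE : forall p, dmap i (xi p) = - J (i p) (N p);
  th_xisE : forall p, dmap i (xis p) = - Js (i p) (N p) }.

(* [Dt] and [Dts] are the pullbacks along [i] of the ambient connection and
   of its dual. *)
Record gauss_weingarten (R : realType) (n : nat) (M : manifold R n)
    (M' : manifold R n.+1) (i : M -> M') (g : tbilin R M')
    (Dt Dts : conn_op R M M') (N : M -> tvec R M') (xi xis : tfield R M)
    (D Ds : conn R M) (A As : tendo R M) (theta : tform R M)
    (eps := fun p => induced_metric i g p (xi p) (xis p))
    : Prop := GaussWeingarten {
  gw_conn : affine_connection D;
  gw_dual_conn : affine_connection Ds;
  gw_shape : endo_field A;
  gw_dual_shape : endo_field As;
  gw_theta : one_form theta;
  gw_gauss : forall X Y, vector_field X -> vector_field Y -> forall p,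
    Dt X (fun q => dmap i (Y q)) p =
      dmap i (D X Y p)
      + (eps p * induced_metric i g p (As p (X p)) (Y p)) *: N p;
  gw_weingarten : forall X, vector_field X -> forall p,
    Dt X N p = - dmap i (A p (X p)) + (eps p * theta p (X p)) *: N p;
  gw_dual_gauss : forall X Y, vector_field X -> vector_field Y -> forall p,
    Dts X (fun q => dmap i (Y q)) p =
      dmap i (Ds X Y p)
      + (eps p * induced_metric i g p (A p (X p)) (Y p)) *: N p;
  gw_dual_weingarten : forall X, vector_field X -> forall p,
    Dts X N p = - dmap i (As p (X p)) - (eps p * theta p (X p)) *: N p }.

Definition hopf (R : realType) (n : nat) (M : manifold R n) (A As : tendo R M)
    (xi xis : tfield R M) : Prop :=
  exists rho rhos : M -> R, [/\ smooth_fun rho, smooth_fun rhos,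
    forall p, A p (xi p) = rho p *: xi p &
    forall p, As p (xis p) = rhos p *: xis p].

(** * Geodesic vector fields *)

(* On a Hopf hypersurface of a Kaehler-like statistical manifold the formulas
   of [gauss_weingarten] give, with no further assumption,
     Ds xis xis = (- eps * theta xis) *: xis,
   so [geodesic Ds xis] always holds, whereas theta xis need not vanish.  It is
   [unit_geodesic Ds xis], i.e. the vanishing of the factor zeta (the usual
   "geodesic" condition), that theta xis = 0 can characterize. *)

Definition geodesic_with (R : realType) (n : nat) (M : manifold R n)
    (D : conn R M) (X : tfield R M) (zeta : M -> R) : Prop :=
  forall p, D X X p = zeta p *: X p.

Definition geodesic (R : realType) (n : nat) (M : manifold R n) (D : conn R M)
    (X : tfield R M) : Prop :=
  exists2 zeta : M -> R, smooth_fun zeta & geodesic_with D X zeta.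

Definition unit_geodesic (R : realType) (n : nat) (M : manifold R n)
    (D : conn R M) (X : tfield R M) : Prop :=
  geodesic_with D X (fun=> 0).

(* Main.v *)
(* The defect Dts_X (Js V) - Js (Dts_X V) is tensorial in the field V along the
   immersion [i].  It vanishes on restrictions of ambient fields, because the
   parallelism of J for nablat dualizes to that of Js for nablats, hence it
   vanishes on all V by expansion in a local frame of global ambient fields.
   For V = N and X = xis, the Weingarten formula and the Hopf condition give
     Dts_xis (i_* xis) = - Js (Dts_xis N) = rhos N - eps theta(xis) i_* xis,
   whose tangential part, by the Gauss formula, is
     nablas_xis xis = - eps theta(xis) xis.
   Finally eps = g(N, N) = +-1 and xis has no zero. *)
Require Import Defs.
From HB Require Import structures.
From mathcomp Require Import all_boot all_order all_algebra.
From mathcomp Require Import all_classical all_reals all_analysis.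
From mathcomp Require Import ring lra.

Set Implicit Arguments.
Unset Strict Implicit.
Unset Printing Implicit Defensive.
Import Order.TTheory GRing.Theory Num.Theory numFieldNormedType.Exports.
Local Open Scope classical_set_scope.
Local Open Scope ring_scope.

(** * Calculus of [Ck] functions on open subsets of R^n *)

Lemma near_eq_differentiable (R : realType) (V W : normedModType R)
    (f g : V -> W) (x : V) :
  (\near x, f x = g x) -> differentiable f x -> differentiable g x.
Proof.
move=> fg df.
have fgx : f x = g x by exact: nbhs_singleton fg.
have e : g \o shift x = cst (g x) + 'd f x +o_ 0 id.
  apply/eqaddoP => _/posnumP[eps].
  have /eqaddoP/(_ _ (gt0 eps)) H := diff_locally df.
  have fg' : \forall h \near (0 : V), f (h + x) = g (h + x).
    move: fg; rewrite (near_shift 0 x); apply: filterS => h /=.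
    by rewrite subr0.
  near=> h; rewrite /= -fgx.
  have -> : (g \o shift x - (cst (f x) + 'd f x)) h
         = (f \o shift x - (cst (f x) + 'd f x)) h.
    rewrite /= !fctE; congr (_ - _) => /=; apply/esym; near: h; exact: fg'.
  near: h; exact: H.
have dc : continuous ('d f x) by exact: diff_continuous.
apply/diff_locallyP; rewrite (diff_unique dc e); split => //.
Unshelve. all: by end_near. Qed.

Section Ck_calculus.
Context {R : realType} {n : nat}.
Implicit Types (U : set 'rV[R]_n) (f g : 'rV[R]_n -> R).

(** Openness of [U] turns equality on [U] into equality near each of its points, so directional
    derivatives agree on [U] too. *)
Lemma Ck_eq k U f g : open U -> (forall x, U x -> f x = g x) ->
  Ck k U f -> Ck k U g.
Proof.
move=> oU; elim: k f g => [|k IH] f g fg /=.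
  move=> cf x Ux; have fgx : \near x, f x = g x.
    by apply: filterS (open_nbhs_nbhs (conj oU Ux)) => y /fg.
  change (g @ nbhs x --> g x); rewrite -(fg _ Ux).
  exact: cvg_trans (near_eq_cvg fgx) (cf x Ux).
have fgn x : U x -> \near x, f x = g x.
  by move=> Ux; apply: filterS (open_nbhs_nbhs (conj oU Ux)) => y /fg.
move=> [df cf]; split.
  by move=> x Ux; exact: near_eq_differentiable (fgn _ Ux) (df _ Ux).
by move=> v; apply: IH (cf v) => x /fgn; exact: near_eq_derive.
Qed.

Lemma CkW k U f : Ck k.+1 U f -> Ck k U f.
Proof.
elim: k f => [|k IH] f /= [df cf].
  by move=> x Ux; apply: differentiable_continuous; exact: df.
by split=> // v; exact: IH (cf v).
Qed.

Lemma Ck_sub k U V f : V `<=` U -> Ck k U f -> Ck k V f.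
Proof.
move=> VU; elim: k f => [|k IH] f /=; first by move=> cf x /VU; exact: cf.
by move=> [df cf]; split=> [x /VU|v]; [exact: df | exact: IH].
Qed.

(** The conditions in [Ck] are tested at single points, on functions defined everywhere, so
    arbitrary sets covering [U] suffice. *)
Lemma Ck_cover k U f :
  (forall x, U x -> exists2 V, V x & Ck k V f) -> Ck k U f.
Proof.
elim: k f => [|k IH] f /= H.
  by move=> x /H[V Vx cf]; exact: cf.
split=> [x /H[V Vx [df _]]|v]; first exact: df.
by apply: IH => x /H[V Vx [_ cf]]; exists V.
Qed.

Lemma Ck_cst k U (a : R) : Ck k U (fun=> a).
Proof.
elim: k a => [|k IH] a /=; first by move=> x _; exact: cst_continuous.
split=> [x _|v]; first exact: differentiable_cst.
have -> : (fun x => 'D_v (fun=> a) x) = fun=> 0 :> R; last exact: IH.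
by apply/funext => x; exact: derive_cst.
Qed.

Lemma CkD k U f g : open U -> Ck k U f -> Ck k U g ->
  Ck k U (fun x => f x + g x).
Proof.
move=> oU; elim: k f g => [|k IH] f g /=.
  by move=> cf cg x Ux; exact: continuousD (cf _ Ux) (cg _ Ux).
move=> [df cf] [dg cg]; split=> [x Ux|v].
  by apply: differentiableD; [exact: df|exact: dg].
apply: Ck_eq (IH _ _ (cf v) (cg v)) => // x Ux; apply/esym.
by apply: deriveD; apply: diff_derivable; [exact: df|exact: dg].
Qed.

Lemma CkM k U f g : open U -> Ck k U f -> Ck k U g ->
  Ck k U (fun x => f x * g x).
Proof.
move=> oU; elim: k f g => [|k IH] f g.
  by move=> cf cg x Ux; exact: continuousM (cf _ Ux) (cg _ Ux).
(* The derivative of a product contains [f] and [g] undifferentiated, so both are also brought down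
   to order [k]. *)
move=> cf1 cg1; have [cf0 cg0] := (CkW cf1, CkW cg1).
move: cf1 cg1 => /= [df cf] [dg cg]; split=> [x Ux|v].
  by apply: differentiableM; [exact: df|exact: dg].
have H1 := IH _ _ cf0 (cg v); have H2 := IH _ _ cg0 (cf v).
apply: Ck_eq (CkD oU H1 H2) => // x Ux; apply/esym.
by apply: deriveM; apply: diff_derivable; [exact: df|exact: dg].
Qed.

Lemma Ck_sum k U m (f : 'I_m -> 'rV[R]_n -> R) : open U ->
  (forall j, Ck k U (f j)) -> Ck k U (fun x => \sum_j f j x).
Proof.
move=> oU; elim: m f => [|m IH] f cf.
  apply: Ck_eq (Ck_cst k U 0) => // x _; by rewrite big_ord0.
have cw := IH (fun j => f (widen_ord (leqnSn m) j)) (fun j => cf _).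
apply: Ck_eq (CkD oU cw (cf ord_max)) => //.
by move=> x _; rewrite big_ord_recr.
Qed.

Lemma Ck_coord k U j : Ck k U (fun x => x 0 j).
Proof.
case: k => [|k] /=; first by move=> x _; exact: coord_continuous.
split=> [x _|v]; first exact: differentiable_coord.
have -> : (fun x => 'D_v (fun y : 'rV[R]_n => y 0 j) x) = fun=> v 0 j;
  last exact: Ck_cst.
apply/funext => x; rewrite deriveE; last exact: differentiable_coord.
(* The coordinate is packaged as a linear map, so that [diff_lin] makes it its own differential. *)
have @h : {linear 'rV[R]_n -> R}.
  by exists (fun N : 'rV[R]_n => N 0 j); do 2![eexists]; do ?[constructor];
     rewrite ?mxE// => ? *; rewrite ?mxE//; move=> ?; rewrite !mxE.
rewrite (_ : (fun _ => _) = h) // diff_lin //; exact/coord_continuous.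
Qed.

End Ck_calculus.

(** * The chain rule and composition of [Ck] maps *)

Section Ck_composition.
Context {R : realType} {m n : nat}.
Variables (U : set 'rV[R]_m) (V : set 'rV[R]_n).
Variable (phi : 'rV[R]_m -> 'rV[R]_n).

Lemma differentiable_row x :
  (forall j, differentiable (fun y => phi y 0 j) x) -> differentiable phi x.
Proof.
move=> dphi.
rewrite (_ : phi = \sum_j (fun y => phi y 0 j *: delta_mx 0 j)).
  apply: differentiable_sum => j; exact: differentiableZl.
apply/funext => y; rewrite fct_sumE; exact: row_sum_delta.
Qed.

Lemma derive_coord x v j : differentiable phi x ->
  ('D_v phi x) 0 j = 'D_v (fun y => phi y 0 j) x.
Proof.
move=> dphi; have dv : derivable phi x v by exact: diff_derivable.
by rewrite (derive_mx dv) mxE.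
Qed.

Lemma derive_rowE (f : 'rV[R]_n -> R) x v : differentiable f x ->
  'D_v f x = \sum_j v 0 j * 'D_(delta_mx 0 j) f x.
Proof.
move=> df; rewrite deriveE // [in LHS](row_sum_delta v) linear_sum.
apply: eq_bigr => j _; rewrite linearZ /= deriveE //.
Qed.

Lemma derive_comp (f : 'rV[R]_n -> R) x v :
  differentiable phi x -> differentiable f (phi x) ->
  'D_v (f \o phi) x = 'D_('D_v phi x) f (phi x).
Proof.
move=> dphi df.
rewrite deriveE; last exact: differentiable_comp.
by rewrite diff_comp //= -!deriveE.
Qed.

Lemma Ck_comp k (f : 'rV[R]_n -> R) : open U -> open V ->
  (forall j, Ck k U (fun y => phi y 0 j)) -> (forall x, U x -> V (phi x)) ->
  Ck k V f -> Ck k U (f \o phi).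
Proof.
move=> oU oV; elim: k f => [|k IH] f cphi UV.
  move=> cf x Ux; apply: continuous_comp; last exact: cf (UV _ Ux).
  rewrite (_ : phi = fun y => \sum_j phi y 0 j *: delta_mx 0 j); last first.
    by apply/funext => y; exact: row_sum_delta.
  change ((\sum_j phi y 0 j *: (delta_mx 0 j : 'rV[R]_n)) @[y --> nbhs x] -->
          \sum_j phi x 0 j *: (delta_mx 0 j : 'rV[R]_n)).
  apply: cvg_big => [|j _]; first exact: add_continuous.
  by apply: cvgZr_tmp; exact: (cphi j x Ux).
move=> [df cf].
have dphi x : U x -> differentiable phi x.
  by move=> Ux; apply: differentiable_row => j; exact: (cphi j).1.
split=> [x Ux|v].
  by apply: differentiable_comp; [exact: dphi|exact/df/UV].
(* By the chain rule the derivative of [f \o phi] is the sum of these products; the induction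
   hypothesis applies to the partial derivatives of [f]. *)
have H j : Ck k U (fun x => 'D_v (fun y => phi y 0 j) x *
    ('D_(delta_mx 0 j) f \o phi) x).
  apply: CkM => //; first exact: (cphi j).2.
  by apply: IH => // [j'|]; [exact: CkW|exact: cf].
apply: Ck_eq (Ck_sum oU H) => // x Ux.
rewrite derive_comp; [|exact: dphi|exact/df/UV].
rewrite derive_rowE; last exact/df/UV.
by apply: eq_bigr => j _; rewrite derive_coord //; exact: dphi.
Qed.

End Ck_composition.

(** * Flat functions and smooth bump functions on R^n *)

Section flat_function.
Context {R : realType}.

(** [flat 0] is the classical function exp(-1/t) extended by 0. The powers of 1/t close the family,
    up to linear combinations, under differentiation. *)
Definition flat (n : nat) (t : R) : R :=
  if 0 < t then t^-1 ^+ n * expR (- t^-1) else 0.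

(** With s = 1/t, the bound exp(s) >= s^(n+1) / (n+1)! leaves a spare factor t. This linear decay
    yields differentiability of the whole family at 0. *)
Lemma flat_le n t : `|flat n t| <= (n.+1)`!%:R * `|t|.
Proof.
rewrite /flat; case: ifPn => t0; last by rewrite normr0 mulr_ge0.
have s0 : 0 < t^-1 by rewrite invr_gt0.
rewrite ger0_norm ?mulr_ge0 ?exprn_ge0 ?expR_ge0 ?(ltW s0) // gtr0_norm //.
rewrite expRN ler_pdivrMr ?expR_gt0 //.
have := expR_ge1Dxn n (ltW s0).
set e := expR _; set F := _%:R => H.
have F0 : 0 < F by rewrite ltr0n fact_gt0.
have : t^-1 ^+ n.+1 / F <= e by apply: le_trans H; rewrite lerDr.
rewrite ler_pdivrMr // exprSr ler_pdivrMr //.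
by have -> : F * t * e = e * F * t by ring.
Qed.

Lemma flat_is_derive n (t : R) :
  is_derive t (1 : R) (flat n) (flat n.+2 t - n%:R * flat n.+1 t).
Proof.
have [t0|t0|->] := ltgtP t 0.
- have : is_derive t (1 : R) (cst 0 : R -> R) (flat n.+2 t - n%:R * flat n.+1 t).
    by apply: is_derive_eq; rewrite /flat ltNge (ltW t0) /= mulr0 subrr.
  apply: near_eq_is_derive => //; near=> s.
  rewrite /flat ltNge ifF //; apply/negbF/ltW; near: s.
  exact: lt_nbhsl.
- have : is_derive t (1 : R) (fun s : R => s^-1 ^+ n * expR (- s^-1))
           (flat n.+2 t - n%:R * flat n.+1 t).
    have tn0 : t != 0 by rewrite gt_eqF.
    have dV : is_derive t (1 : R) (fun s : R => s^-1) (- t ^- 2).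
      have := is_deriveV (f := id) tn0 (is_derive_id t 1).
      by rewrite /GRing.scale /= mulr1.
    have dX := is_deriveX n dV.
    have dE := @is_derive1_comp _ expR _ _ _ _ (is_derive_expR _) (is_deriveN dV).
    have := is_deriveM dX dE.
    rewrite (_ : _ * _ = fun s : R => s^-1 ^+ n * expR (- s^-1)); last first.
      by apply/funext => s; rewrite !fctE.
    move=> /is_derive_eq; apply.
    rewrite /flat t0 /GRing.scale /= !fctE.
    rewrite -exprVn; case: n {dX} => [|k]; rewrite /= ?mulr0n ?mul0r ?mulr0.
      by rewrite subr0 addr0 opprK expr0 mul1r mulrC.
    rewrite !(exprS _ k.+2) !(exprS _ k.+1) !(exprS _ k).
    set e := expR _; set a : R := k.+1%:R; set uk := t^-1 ^+ k.
    by move: e a uk => e a uk; ring.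
  apply: near_eq_is_derive => //; near=> s.
  rewrite /flat ifT //; near: s.
  exact: lt_nbhsr.
- rewrite /flat ltxx mulr0 subrr.
  (* The difference quotient of [flat n] at 0 is [flat n.+1 h], which [flat_le] sends to 0. *)
  have H : h^-1 *: ((flat n \o shift 0) (h *: 1) - flat n 0) @[h --> 0^'] --> (0 : R).
    apply/cvgr0Pnorm_lt => e e0; near=> h.
    have h0 : h != 0 by near: h; exact: nbhs_dnbhs_neq.
    have -> : h^-1 *: ((flat n \o shift 0) (h *: 1) - flat n 0) = flat n.+1 h.
      rewrite /= addr0 /GRing.scale /= mulr1 {2}/flat ltxx subr0 /flat.
      by case: ifP => _; rewrite ?mulr0 // mulrA -exprS.
    apply: le_lt_trans (flat_le _ _) _.
    rewrite -ltr_pdivlMl ?ltr0n ?fact_gt0 //; near: h.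
    by apply: dnbhs0_lt; rewrite mulr_gt0 // invr_gt0 ltr0n fact_gt0.
  apply: DeriveDef; last exact: cvg_lim H.
  by apply/cvg_ex; exists 0.
Unshelve. all: by end_near. Qed.

Lemma flat_differentiable n t : differentiable (flat n) t.
Proof. by apply/derivable1_diffP; have [] := flat_is_derive n t. Qed.

Context {m : nat}.
Implicit Types (U : set 'rV[R]_m) (s : 'rV[R]_m -> R).

Lemma derive_flat_comp n s x v : differentiable s x ->
  'D_v (fun y => flat n (s y)) x =
  (flat n.+2 (s x) - n%:R * flat n.+1 (s x)) * 'D_v s x.
Proof.
move=> ds; have df := flat_differentiable n (s x).
rewrite deriveE; last exact: (differentiable_comp ds df).
rewrite (diff_comp ds df) /= -(deriveE v ds).
have [d <-] := flat_is_derive n (s x).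
have := congr1 (@^~ ('D_v s x)) (deriv1E d).
by rewrite /= => ->; rewrite derive1E mulrC.
Qed.

Lemma Ck_flat_comp k n U s : open U -> Ck k U s ->
  Ck k U (fun y => flat n (s y)).
Proof.
move=> oU; elim: k n s => [|k IH] n s.
  move=> cs x Ux.
  apply: (@continuous_comp _ _ _ s (flat n)); first exact: cs.
  exact/differentiable_continuous/flat_differentiable.
move=> cs; have cs0 := CkW cs; case: cs => ds cs; split=> [x Ux|v].
  apply: (@differentiable_comp _ _ _ _ s (flat n)); first exact: ds.
  exact: flat_differentiable.
have H : Ck k U (fun y => (flat n.+2 (s y) + - n%:R * flat n.+1 (s y)) * 'D_v s y).
  have A := CkM oU (Ck_cst k U (- n%:R)) (IH n.+1 _ cs0).
  exact: CkM oU (CkD oU (IH n.+2 _ cs0) A) (cs v).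
apply: Ck_eq H => // x Ux.
by rewrite derive_flat_comp ?mulNr //; exact: ds.
Qed.

(** The bump is a rescaled [flat 0] of the polynomial r^2 - |y - x0|^2, with the Euclidean distance
    for the sake of smoothness. The compact set is a closed ball of the sup norm, which contains the
    Euclidean ball. *)
Lemma smooth_bump U x0 : open U -> U x0 ->
  exists (b : 'rV[R]_m -> R) (K : set 'rV[R]_m),
    [/\ smooth_on setT b, compact K, K `<=` U, b x0 = 1 &
        forall y, ~ K y -> b y = 0].
Proof.
move=> oU Ux0.
have /nbhs_ballP[e /= e0 eU] := open_nbhs_nbhs (conj oU Ux0).
(* Half the radius keeps the closed ball of radius [r] inside the open ball of radius [e]. *)
pose r := e / 2.
have r0 : 0 < r by rewrite divr_gt0.
pose s (y : 'rV[R]_m) := r ^+ 2 - \sum_j (y 0 j - x0 0 j) ^+ 2.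
have ss : smooth_on setT s.
  move=> k.
  have A j : Ck k setT (fun y : 'rV[R]_m => y 0 j + - x0 0 j).
    exact: CkD openT (Ck_coord _ _ _) (Ck_cst _ _ _).
  have H j := CkM openT (A j) (A j).
  have H1 : Ck k setT (fun y =>
      r ^+ 2 + (-1) * \sum_j (y 0 j - x0 0 j) * (y 0 j - x0 0 j)).
    apply: CkD; [exact: openT|exact: Ck_cst|].
    by apply: CkM; [exact: openT|exact: Ck_cst|apply: Ck_sum; [exact: openT|]].
  by apply: Ck_eq H1 => //; [exact: openT|move=> y _; rewrite mulN1r].
have s0 : s x0 = r ^+ 2.
  by rewrite /s big1 ?subr0 // => j _; rewrite subrr expr0n.
have f0 : 0 < flat 0 (s x0) by rewrite s0 /flat exprn_gt0 // expr0 mul1r expR_gt0.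
exists (fun y => (flat 0 (s x0))^-1 * flat 0 (s y)).
exists (closed_ball_ Num.norm x0 r); split.
- move=> k; apply: CkM; [exact: openT|exact: Ck_cst|].
  by apply: Ck_flat_comp; [exact: openT|exact: ss].
- apply: bounded_closed_compact; last exact: closed_closed_ball_.
  exists (`|x0| + r); split; first by rewrite num_real.
  move=> M hM y /= yr; apply/ltW/(le_lt_trans _ hM).
  by rewrite -[y](subrK x0) addrC (le_trans (ler_normD _ _)) // lerD2l distrC.
- move=> y yr; apply: eU; rewrite -ball_normE /=.
  by apply: le_lt_trans yr _; rewrite /r ltr_pdivrMr // mulr_natr mulr2n ltrDl.
- by rewrite mulVf // gt_eqF.
(* If [s y] is positive, the sum of squares is below [r ^+ 2], hence so is the square of each
   coordinate difference, and [y] lies in [K]. *)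
- move=> y ny; rewrite [flat 0 (s y)]ifF ?mulr0 //; apply: contra_notF ny => sy0.
  rewrite /closed_ball_ /=.
  rewrite [leLHS]/Num.norm /= mx_normrE; apply: bigmax_le; first exact: ltW.
  move=> [i j] _ /=; rewrite ord1 !mxE.
  rewrite -(ler_pXn2r (ltn0Sn 1)) ?nnegrE ?(ltW r0) //.
  apply: ltW; apply: le_lt_trans (_ : \sum_j (y 0 j - x0 0 j) ^+ 2 < _); last first.
    by rewrite -subr_gt0.
  rewrite real_normK ?num_real // (bigD1 j) //= -opprB sqrrN lerDl.
  apply: sumr_ge0 => k _.
  exact: sqr_ge0.
Qed.

End flat_function.

(** * Charts and smooth functions on manifolds *)

Section charts.
Context {R : realType} {n : nat} {T : topologicalType}.
Variable c : chart R n T.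

Lemma cinv_dom y : (cmap c @` cdom c) y -> cdom c (cinv c y).
Proof. by move=> [p cp <-]; rewrite cmapK. Qed.

(** Near each of its points the image contains the intersection of the open chart image with the
    preimage of [O] under [cinv c], which is a neighbourhood by continuity. *)
Lemma open_chart_image (O : set T) : open O -> open (cmap c @` (cdom c `&` O)).
Proof.
move=> oO; rewrite openE => y [p [cp Op] <-{y}].
have cy : (cmap c @` cdom c) (cmap c p) by exists p.
have nO : nbhs (cmap c p) (cinv c @^-1` O).
  by apply: (cinv_cont cy); rewrite /= cmapK //; exact: open_nbhs_nbhs.
have nc := open_nbhs_nbhs (conj (@cimg_open _ _ _ c) cy).
apply: filterS (filterI nc nO) => y [[q cq <-]] /=; rewrite cmapK // => Oq.
by exists q.
Qed.

Lemma near_chart (O : set T) p : open O -> cdom c p -> O p ->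
  \forall y \near cmap c p, (cmap c @` (cdom c `&` O)) y.
Proof.
move=> oO cp Op; apply: open_nbhs_nbhs; split; first exact: open_chart_image.
by exists p.
Qed.

End charts.

Section smooth_functions.
Context {R : realType} {n : nat} {M : manifold R n}.
Implicit Types f g : M -> R.

Lemma smooth_fun_cover f :
  (forall c p, atlas c -> cdom c p -> exists W : set M, [/\ open W, W p &
     smooth_on (cmap c @` (cdom c `&` W)) (f \o cinv c)]) ->
  smooth_fun f.
Proof.
move=> H c ac k; apply: Ck_cover => _ [p cp <-].
have [W [oW Wp sW]] := H c p ac cp.
by exists (cmap c @` (cdom c `&` W)); [exists p|exact: sW].
Qed.

Lemma smooth_fun_cst (a : R) : smooth_fun (fun _ : M => a).
Proof. by move=> c ac k; exact: Ck_cst. Qed.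

Lemma smooth_funD f g : smooth_fun f -> smooth_fun g ->
  smooth_fun (fun p => f p + g p).
Proof.
by move=> sf sg c ac k; apply: CkD; [exact: cimg_open|exact: sf|exact: sg].
Qed.

Lemma smooth_funM f g : smooth_fun f -> smooth_fun g ->
  smooth_fun (fun p => f p * g p).
Proof.
by move=> sf sg c ac k; apply: CkM; [exact: cimg_open|exact: sf|exact: sg].
Qed.

Lemma smooth_funN f : smooth_fun f -> smooth_fun (fun p => - f p).
Proof.
move=> sf; rewrite (_ : (fun _ => _) = fun p => -1 * f p).
  by apply: smooth_funM => //; exact: smooth_fun_cst.
by apply/funext => p; rewrite mulN1r.
Qed.

Lemma smooth_fun_differentiable f c p : smooth_fun f -> atlas c -> cdom c p ->
  differentiable (f \o cinv c) (cmap c p).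
Proof. by move=> sf ac cp; apply: (sf c ac 1).1; exists p. Qed.

Definition chart_extension (c : chart R n M) (phi : 'rV[R]_n -> R) (p : M) : R :=
  if `[< cdom c p >] then phi (cmap c p) else 0.

(** Around a point of the chart domain this is a change of charts; any other point has a
    neighbourhood that misses the support, where the extension is 0. *)
Lemma smooth_chart_extension c phi (K : set 'rV[R]_n) : atlas c -> compact K ->
  K `<=` cmap c @` cdom c -> smooth_on (cmap c @` cdom c) phi ->
  (forall y, ~ K y -> phi y = 0) -> smooth_fun (chart_extension c phi).
Proof.
move=> ac cK Kc sphi phi0; apply: smooth_fun_cover => c1 p ac1 c1p.
have [cp|ncp] := pselect (cdom c p).
  exists (cdom c); split=> //; first exact: cdom_open.
  have oU := open_chart_image (c := c1) (@cdom_open _ _ _ c).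
  have H x : (cmap c1 @` (cdom c1 `&` cdom c)) x ->
      (cmap c @` cdom c) (cmap c (cinv c1 x)).
    by move=> [q [c1q cq] <-]; exists q => //=; rewrite cmapK.
  move=> k; have := Ck_comp oU (@cimg_open _ _ _ c)
    (fun j => atlas_compatible ac1 ac j k) H (sphi k).
  apply: Ck_eq => //.
  move=> _ [q [c1q cq] <-] /=.
  by rewrite /chart_extension cmapK // asboolT.
(* The Hausdorff property enters here: the compact image of [K] in the manifold is closed. *)
have oK : open (~` (cinv c @` K)).
  apply: closed_openC; apply: compact_closed; first exact: carrier_hausdorff.
  apply: continuous_compact => //; apply: continuous_in_subspaceT => y.
  by rewrite inE => /Kc; exact: cinv_cont.
exists (~` (cinv c @` K)); split=> //.
  by move=> [y Ky yp]; apply: ncp; rewrite -yp; exact/cinv_dom/Kc.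
move=> k; have oU := open_chart_image (c := c1) oK.
apply: Ck_eq (Ck_cst k _ 0) => // _ [q [c1q nKq] <-] /=.
rewrite /chart_extension cmapK //; case: asboolP => // cq.
by rewrite phi0 // => Kq; apply: nKq; exists (cmap c q); rewrite ?cmapK.
Qed.

End smooth_functions.

(** * Smooth maps and push-forward of tangent vectors *)

Section smooth_maps.
Context {R : realType} {m n : nat} {M : manifold R m} {M' : manifold R n}.
Variables (f : M -> M') (sf : smooth_map f).

Lemma smooth_map_open O : open O -> open (f @^-1` O).
Proof. by have [cf _] := sf; move/continuousP: cf; exact. Qed.

Lemma smooth_fun_comp h : smooth_fun h -> smooth_fun (h \o f).
Proof.
move=> sh; apply: smooth_fun_cover => c p ac cp.
have [c' ac' c'p] := atlas_cover (f p).
exists (f @^-1` cdom c'); split=> //; first exact/smooth_map_open/cdom_open.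
move=> k.
have oU := open_chart_image (c := c) (smooth_map_open (@cdom_open _ _ _ c')).
have H : forall x, (cmap c @` (cdom c `&` f @^-1` cdom c')) x ->
    (cmap c' @` cdom c') (cmap c' (f (cinv c x))).
  by move=> _ [q [cq c'q] <-]; rewrite cmapK //; exists (f q).
have := Ck_comp oU (@cimg_open _ _ _ c')
  (fun j => sf.2 c c' ac ac' j k) H (sh c' ac' k).
apply: Ck_eq => // _ [q [cq c'q] <-] /=.
by rewrite cmapK // cmapK.
Qed.

End smooth_maps.

Lemma smooth_map_id (R : realType) (n : nat) (M : manifold R n) :
  smooth_map (idfun : M -> M).
Proof. by split=> [p|c c' ac ac' j]; [exact: cvg_id|exact: atlas_compatible]. Qed.

(** The functional occurring in [tangent], with its chart and components made explicit for
    computations in coordinates. *)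
Definition chart_vec (R : realType) (n : nat) (M : manifold R n)
    (c : chart R n M) (p : M) (a : 'rV[R]_n) : tvec R M :=
  fun h => if `[< smooth_fun h >] then 'D_a (h \o cinv c) (cmap c p) else 0.

Section push_forward.
Context {R : realType} {m n : nat} {M : manifold R m} {M' : manifold R n}.
Variables (f : M -> M') (sf : smooth_map f).

(** This is the chain rule: the Jacobian of [f] in the two charts transforms the components. *)
Lemma dmap_chart_vec c c' p a : atlas c -> cdom c p -> atlas c' ->
  cdom c' (f p) -> dmap f (chart_vec c p a) =
  chart_vec c' (f p) ('D_a (fun y => cmap c' (f (cinv c y))) (cmap c p)).
Proof.
move=> ac cp ac' c'p; apply/funext => h; rewrite /dmap /chart_vec.
case: asboolP => // sh; rewrite asboolT; last exact: smooth_fun_comp.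
pose phi y := cmap c' (f (cinv c y)).
have dphi : differentiable phi (cmap c p).
  apply: differentiable_row => j; apply: (sf.2 c c' ac ac' j 1).1.
  by exists p.
have phip : phi (cmap c p) = cmap c' (f p) by rewrite /phi cmapK.
have dh : differentiable (h \o cinv c') (phi (cmap c p)).
  by rewrite phip; exact: smooth_fun_differentiable.
rewrite -phip -derive_comp //; apply: near_eq_derive.
have oW := smooth_map_open sf (@cdom_open _ _ _ c').
apply: filterS (near_chart oW cp c'p) => _ [q [cq c'q] <-].
by rewrite /phi /= cmapK // cmapK.
Qed.

Lemma tangent_dmap p v : tangent p v -> tangent (f p) (dmap f v).
Proof.
move=> [c [a [ac cp ->]]]; have [c' ac' c'p] := atlas_cover (f p).
rewrite -/(chart_vec c p a) (dmap_chart_vec _ ac cp ac' c'p).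
by eexists; eexists; split; [exact: ac'|exact: c'p|reflexivity].
Qed.

Lemma field_along_comp Y : vector_field Y -> field_along f (fun p => Y (f p)).
Proof.
move=> [tY sY]; split=> [p|h sh]; first exact: tY.
exact: smooth_fun_comp (sY h sh).
Qed.

Lemma field_along_dmap X : vector_field X -> field_along f (fun p => dmap f (X p)).
Proof.
move=> [tX sX]; split=> [p|h sh]; first exact/tangent_dmap/tX.
by rewrite /dmap asboolT //; exact/sX/smooth_fun_comp.
Qed.

End push_forward.

(** * Tangent spaces in coordinates *)

Section tangent_space.
Context {R : realType} {n : nat} {M : manifold R n}.
Implicit Types (p : M) (u v : tvec R M).

Lemma tangent_chart_vec c p a : atlas c -> cdom c p -> tangent p (chart_vec c p a).
Proof. by move=> ac cp; exists c, a. Qed.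

Lemma tangent_in_chart c p v : atlas c -> cdom c p -> tangent p v ->
  exists a, v = chart_vec c p a.
Proof.
move=> ac cp [c1 [a [ac1 c1p ->]]]; rewrite -/(chart_vec c1 p a).
(* A change of chart is the push-forward by the identity, which leaves the functional itself
   unchanged. *)
have := dmap_chart_vec (smooth_map_id M) a ac1 c1p ac cp.
rewrite (_ : dmap idfun _ = chart_vec c1 p a) => [->|].
  by eexists; reflexivity.
by apply/funext => h; rewrite /dmap /chart_vec; case: asboolP.
Qed.

Lemma chart_vec_lin c p k a b : atlas c -> cdom c p ->
  chart_vec c p (k *: a + b) = k *: chart_vec c p a + chart_vec c p b.
Proof.
move=> ac cp; apply/funext => h.
rewrite !fctE /chart_vec; case: asboolP => sh; last by rewrite scaler0 addr0.
have dh := smooth_fun_differentiable sh ac cp.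
by rewrite !deriveE // linearP.
Qed.

Lemma chart_vec_sum c p a : atlas c -> cdom c p ->
  chart_vec c p a = \sum_j a 0 j *: chart_vec c p (delta_mx 0 j).
Proof.
move=> ac cp; apply/funext => h.
rewrite fct_sumE /chart_vec; case: asboolP => sh.
  rewrite derive_rowE; last exact: smooth_fun_differentiable.
  by apply: eq_bigr => j _; rewrite !fctE asboolT.
by rewrite big1 // => j _; rewrite !fctE asboolF // scaler0.
Qed.

Lemma tangent_lin p k u v : tangent p u -> tangent p v ->
  tangent p (k *: u + v).
Proof.
have [c ac cp] := atlas_cover p.
move=> /(tangent_in_chart ac cp)[a ->] /(tangent_in_chart ac cp)[b ->].
by rewrite -chart_vec_lin //; exact: tangent_chart_vec.
Qed.

Lemma tangent0 p : tangent p (0 : tvec R M).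
Proof.
have [c ac cp] := atlas_cover p.
have tc := tangent_chart_vec 0 ac cp.
by have := tangent_lin (-1) tc tc; rewrite scaleN1r addNr.
Qed.

Lemma tangentD p u v : tangent p u -> tangent p v -> tangent p (u + v).
Proof. by move=> tu tv; have := tangent_lin 1 tu tv; rewrite scale1r. Qed.

Lemma tangentZ p k u : tangent p u -> tangent p (k *: u).
Proof. by move=> tu; have := tangent_lin k tu (tangent0 p); rewrite addr0. Qed.

Lemma tangentN p u : tangent p u -> tangent p (- u).
Proof. by move=> /(tangentZ (-1)); rewrite scaleN1r. Qed.

Lemma tangent_cst p v (a : R) : tangent p v -> v (fun=> a) = 0.
Proof.
move=> [c [b [ac cp ->]]]; case: asboolP => // _; exact: derive_cst.
Qed.

Lemma tangent_mul p v f g : tangent p v -> smooth_fun f -> smooth_fun g ->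
  v (fun q => f q * g q) = f p * v g + g p * v f.
Proof.
move=> [c [b [ac cp ->]]] sf sg; rewrite !asboolT //; last exact: smooth_funM.
have df := smooth_fun_differentiable sf ac cp.
have dg := smooth_fun_differentiable sg ac cp.
have := deriveM (@diff_derivable _ _ _ _ _ b df)
  (@diff_derivable _ _ _ _ _ b dg).
by rewrite /= cmapK.
Qed.

Lemma tangent_opp p v f : tangent p v -> smooth_fun f ->
  v (fun q => - f q) = - v f.
Proof.
move=> tv sf; rewrite (_ : (fun q => - f q) = fun q => -1 * f q).
  rewrite (tangent_mul tv (smooth_fun_cst _) sf) (tangent_cst _ tv).
  by rewrite mulr0 addr0 mulN1r.
by apply/funext => q; rewrite mulN1r.
Qed.

End tangent_space.

(** * Fields along a map and their covariant derivatives *)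

Section fields_along.
Context {R : realType} {m n : nat} {M : manifold R m} {M' : manifold R n}.
Variable (f : M -> M').

Lemma field_along0 : field_along f (fun=> 0).
Proof. by split=> [p|h sh]; [exact: tangent0|exact: smooth_fun_cst]. Qed.

Lemma field_alongD V W : field_along f V -> field_along f W ->
  field_along f (fun q => V q + W q).
Proof.
move=> [tV sV] [tW sW]; split=> [p|h sh]; first exact: tangentD.
by apply: smooth_funD; [exact: sV|exact: sW].
Qed.

Lemma field_alongZ (a : M -> R) V : smooth_fun a -> field_along f V ->
  field_along f (fun q => a q *: V q).
Proof.
move=> sa [tV sV]; split=> [p|h sh]; first exact: tangentZ.
by apply: smooth_funM; [exact: sa|exact: sV].
Qed.

Lemma field_along_sum (I : Type) (r : seq I) (a : I -> M -> R)
    (V : I -> M -> tvec R M') :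
  (forall k, smooth_fun (a k)) -> (forall k, field_along f (V k)) ->
  field_along f (fun q => \sum_(k <- r) a k q *: V k q).
Proof.
move=> sa fV; elim: r => [|k r IH].
  rewrite (_ : (fun _ => _) = fun=> 0); first exact: field_along0.
  by apply/funext => q; rewrite big_nil.
rewrite (_ : (fun _ => _) =
  fun q => a k q *: V k q + \sum_(k <- r) a k q *: V k q).
  by apply: field_alongD => //; exact: field_alongZ.
by apply/funext => q; rewrite big_cons.
Qed.

Lemma conn_sum D X (I : Type) (r : seq I) (a : I -> M -> R)
    (V : I -> M -> tvec R M') :
  connection_along f D -> vector_field X ->
  (forall k, smooth_fun (a k)) -> (forall k, field_along f (V k)) -> forall p,
  D X (fun q => \sum_(k <- r) a k q *: V k q) p =
  \sum_(k <- r) (X p (a k) *: V k p + a k p *: D X (V k) p).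
Proof.
move=> cD vX sa fV p; elim: r => [|k r IH].
  (* The zero field is written as 0 times itself, so that the Leibniz rule makes its derivative
     vanish. *)
  rewrite big_nil; transitivity (D X (fun=> (0 : R) *: (0 : tvec R M')) p).
    by congr (D X _ p); apply/funext => q; rewrite big_nil scaler0.
  rewrite (conn_leibniz cD (smooth_fun_cst 0) vX field_along0).
  by rewrite scaler0 scale0r addr0.
rewrite big_cons -IH -(conn_leibniz cD (sa k) vX (fV k)).
rewrite -(conn_add cD vX); first last.
- exact: field_along_sum.
- exact: field_alongZ.
by congr (D X _ p); apply/funext => q; rewrite big_cons.
Qed.

End fields_along.

(** * Global vector fields built from bump functions *)

Section bump_fields.
Context {R : realType} {n : nat} {M : manifold R n}.

Definition bump_field (c : chart R n M) (b : 'rV[R]_n -> R) (a : 'rV[R]_n)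
    (p : M) : tvec R M :=
  if `[< cdom c p >] then b (cmap c p) *: chart_vec c p a else 0.

Lemma vector_field_bump c b a (K : set 'rV[R]_n) : atlas c -> compact K ->
  K `<=` cmap c @` cdom c -> smooth_on setT b ->
  (forall y, ~ K y -> b y = 0) -> vector_field (bump_field c b a).
Proof.
move=> ac cK Kc sb b0; split=> [p|h sh].
  rewrite /bump_field; case: asboolP => cp; last exact: tangent0.
  exact/tangentZ/tangent_chart_vec.
have sD : smooth_on (cmap c @` cdom c) (fun y => b y * 'D_a (h \o cinv c) y).
  move=> k; apply: CkM; first exact: cimg_open.
    exact: Ck_sub (sb k).
  exact: (sh c ac k.+1).2.
rewrite (_ : (fun p => _) =
  chart_extension c (fun y => b y * 'D_a (h \o cinv c) y)).
  by apply: (smooth_chart_extension ac cK Kc sD) => // y nKy; rewrite /= b0 ?mul0r.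
apply/funext => p; rewrite /bump_field /chart_extension; case: asboolP => // cp.
by rewrite /chart_vec !fctE asboolT.
Qed.

(** Allows identities between tangent vectors at a point to be deduced from identities between
    global fields. *)
Lemma tangent_extension p v : tangent p v ->
  exists2 X : tfield R M, vector_field X & X p = v.
Proof.
move=> [c [a [ac cp ->]]].
have [b [K [sb cK Kc b1 b0]]] := smooth_bump (@cimg_open _ _ _ c)
  (imageP (cmap c) cp).
exists (bump_field c b a); first exact: (vector_field_bump _ ac cK Kc sb b0).
by rewrite /bump_field asboolT // b1 scale1r.
Qed.

(* With [b] a bump function and [x k] the product of [b] with the [k]-th
   coordinate, [b * v (x k) - x k * v b] is [b ^+ 2] times the [k]-th component
   of [v]: no cut-off equal to 1 near a point is needed. *)
Lemma local_frame (p0 : M) :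
  exists (b : M -> R) (x : 'I_n -> M -> R) (Y : 'I_n -> tfield R M),
  [/\ smooth_fun b, b p0 = 1, forall k, smooth_fun (x k),
      forall k, vector_field (Y k) &
      forall p v, tangent p v -> b p ^+ 3 *: v =
        \sum_k (b p * v (x k) - x k p * v b) *: Y k p].
Proof.
have [c ac cp0] := atlas_cover p0.
have [b [K [sb cK Kc b1 b0]]] := smooth_bump (@cimg_open _ _ _ c)
  (imageP (cmap c) cp0).
have sb' : smooth_on (cmap c @` cdom c) b by move=> k; exact: Ck_sub (sb k).
have sx j : smooth_on (cmap c @` cdom c) (fun y => y 0 j * b y).
  move=> k; apply: CkM; [exact: cimg_open|exact: Ck_coord|exact: sb'].
pose B := chart_extension c b.
pose x j := chart_extension c (fun y => y 0 j * b y).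
have sB : smooth_fun B by exact: (smooth_chart_extension ac cK Kc sb' b0).
have sxE j : smooth_fun (x j).
  by apply: (smooth_chart_extension ac cK Kc (sx j)) => // y nKy; rewrite /= b0 ?mulr0.
exists B, x, (fun j => bump_field c b (delta_mx 0 j)); split=> //.
- by rewrite /B /chart_extension asboolT.
- by move=> j; exact: (vector_field_bump _ ac cK Kc sb b0).
move=> p v tv; have [cp|ncp] := pselect (cdom c p); last first.
  rewrite /B /x /chart_extension asboolF // expr0n scale0r big1 // => j _.
  by rewrite !mul0r subrr scale0r.
have [a ->] := tangent_in_chart ac cp tv.
set y := cmap c p.
have Bp : B p = b y by rewrite /B /chart_extension asboolT.
have nc : \forall z \near y, (cmap c @` cdom c) z.
  apply: open_nbhs_nbhs; split; first exact: cimg_open.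
  by exists p.
have extD phi : smooth_fun (chart_extension c phi) ->
    chart_vec c p a (chart_extension c phi) = 'D_a phi y.
  move=> sphi; rewrite /chart_vec asboolT //; apply: near_eq_derive.
  apply: filterS nc => _ [q cq <-].
  by rewrite /= /chart_extension cmapK // asboolT.
have db : differentiable b y by exact: (sb 1).1.
(* Two of the three factors [b y] come from the coefficients, the third from the frame field
   [bump_field]. *)
transitivity (\sum_j (b y ^+ 3 * a 0 j) *: chart_vec c p (delta_mx 0 j)).
  rewrite Bp [chart_vec c p a]chart_vec_sum // scaler_sumr.
  by apply: eq_bigr => j _; rewrite scalerA.
apply: eq_bigr => j _.
rewrite (extD _ sB) (extD _ (sxE j)) Bp /x /chart_extension asboolT // -/y.
have dj : differentiable (fun z : 'rV[R]_n => z 0 j) y by exact: differentiable_coord.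
have -> : 'D_a (fun z : 'rV[R]_n => z 0 j * b z) y = y 0 j * 'D_a b y + b y * a 0 j.
  have := deriveM (@diff_derivable _ _ _ _ _ a dj)
    (@diff_derivable _ _ _ _ _ a db).
  rewrite -(derive_coord (phi := idfun)) //.
  by rewrite derive_id.
rewrite /bump_field asboolT // scalerA; congr (_ *: _).
rewrite -/y; ring.
Qed.

End bump_fields.

(** * Endomorphism fields and parallelism along a map *)

Section endomorphisms.
Context {R : realType} {n : nat} {M : manifold R n} {J : tendo R M}.
Hypothesis eJ : endo_field J.

Lemma endo0 p : J p 0 = 0.
Proof.
have := endo_lin eJ 1 (tangent0 p) (tangent0 p).
rewrite !scale1r addr0 => /eqP.
by rewrite -subr_eq0 opprD addrA subrr add0r oppr_eq0 => /eqP.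
Qed.

Lemma endoZ p k u : tangent p u -> J p (k *: u) = k *: J p u.
Proof.
move=> tu; have := endo_lin eJ k tu (tangent0 p).
by rewrite addr0 endo0 addr0.
Qed.

Lemma endo_sum p (I : Type) (r : seq I) (a : I -> R) (v : I -> tvec R M) :
  (forall k, tangent p (v k)) ->
  J p (\sum_(k <- r) a k *: v k) = \sum_(k <- r) a k *: J p (v k).
Proof.
move=> tv.
(* Since [endo_lin] speaks of tangent vectors, tangency of the partial sums is carried through the
   induction. *)
suff [] : tangent p (\sum_(k <- r) a k *: v k) /\
  J p (\sum_(k <- r) a k *: v k) = \sum_(k <- r) a k *: J p (v k) by [].
elim: r => [|k r [tS IH]].
  by rewrite !big_nil endo0; split=> //; exact: tangent0.
by rewrite !big_cons; split; [exact: tangent_lin|rewrite (endo_lin eJ) // IH].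
Qed.

End endomorphisms.

Section pullback.
Context {R : realType} {m n : nat} {M : manifold R m} {M' : manifold R n}.
Variables (f : M -> M') (sf : smooth_map f).

(** [D] is tied to [nabla] on restrictions of ambient fields, so [V] is expanded in such fields. The
    factor [b3] makes the expansion valid on all of [M] and equals 1 at [p]. *)
Lemma pullback_parallel nabla D J X V :
  pullback_connection f nabla D -> affine_connection nabla -> endo_field J ->
  (forall Z Y, vector_field Z -> vector_field Y -> forall q,
     nabla Z (fun q => J q (Y q)) q = J q (nabla Z Y q)) ->
  vector_field X -> field_along f V -> field_along f (fun q => J (f q) (V q)) ->
  forall p, D X (fun q => J (f q) (V q)) p = J (f p) (D X V p).
Proof.
move=> [cD pD] aN eJ pJ vX fV fJV p.
have [b [x [Y [sb b1 sx vY bE]]]] := local_frame (f p).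
(* [Z] matches the push-forward of [X] at the single point [p], which is what [pullback_connection]
   asks for. *)
have [Z vZ Zp] := tangent_extension (tangent_dmap sf (vX.1 p)).
pose a k q := b (f q) * V q (x k) - x k (f q) * V q b.
have sbf : smooth_fun (b \o f) by exact: smooth_fun_comp.
pose b3 q := b (f q) ^+ 3.
have sb3 : smooth_fun b3.
  rewrite (_ : b3 = fun q => (b \o f) q * ((b \o f) q * (b \o f) q)).
    by do 2! apply: smooth_funM => //.
  by apply/funext => q; rewrite /b3 exprS expr2.
have b3p : b3 p = 1 by rewrite /b3 b1 expr1n.
have sa k : smooth_fun (a k).
  apply: smooth_funD; first by apply: smooth_funM => //; exact: fV.2.
  apply: smooth_funN; apply: smooth_funM; last exact: fV.2.
  exact: (smooth_fun_comp sf (sx k)).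
have vJY k : vector_field (fun q => J q (Y k q)) by exact: endo_smooth.
have fY k := field_along_comp sf (vY k).
have fJY k := field_along_comp sf (vJY k).
have E1 : (fun q => b3 q *: V q) = fun q => \sum_k a k q *: Y k (f q).
  by apply/funext => q; rewrite /b3 bE //; exact: fV.1.
(* By linearity of [J], the same coefficients [a k] expand the image field in the fields [J Y k]. *)
have E2 : (fun q => b3 q *: J (f q) (V q)) =
    fun q => \sum_k a k q *: J (f q) (Y k (f q)).
  apply/funext => q; rewrite -(endo_sum eJ); last by move=> k; exact: (fY k).1.
  rewrite -(endoZ eJ); last exact: fV.1.
  by congr (J _ _); exact: (congr1 (@^~ q) E1).
have H1 := conn_leibniz cD sb3 vX fV p.
have H2 := conn_leibniz cD sb3 vX fJV p.
have tDV : tangent (f p) (D X V p) by exact: (conn_field cD vX fV).1.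
move: H1; rewrite E1 (conn_sum _ cD vX sa fY) b3p scale1r => /(congr1 (J (f p))).
rewrite (endo_lin eJ) //; last exact: fV.1.
move: H2; rewrite E2 (conn_sum _ cD vX sa fJY) b3p scale1r => H2 H1.
(* The derivative of [b3] contributes this same term to both Leibniz expansions; it cancels, and the
   sums are compared term by term. *)
apply: (addrI (X p b3 *: J (f p) (V p))); rewrite -H1 -H2.
rewrite (_ : J (f p) _ = J (f p)
    (\sum_k (X p (a k) *: Y k (f p) + a k p *: nabla Z (Y k) (f p)))); last first.
  by congr (J _ _); apply: eq_bigr => k _; rewrite (pD X Z (Y k)).
rewrite !big_split /=.
have tN k : tangent (f p) (nabla Z (Y k) (f p)) by exact: (conn_field aN vZ (vY k)).1.
have tS (c : 'I_n -> R) (v : 'I_n -> tvec R M') : (forall k, tangent (f p) (v k)) ->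
    tangent (f p) (\sum_k c k *: v k).
  move=> tv; apply: big_ind; [exact: tangent0|exact: tangentD|].
  by move=> k _; exact: tangentZ.
have -> u v : tangent (f p) u -> tangent (f p) v ->
    J (f p) (u + v) = J (f p) u + J (f p) v.
  by move=> tu tv; have := endo_lin eJ 1 tu tv; rewrite !scale1r.
- rewrite !(endo_sum eJ) //; last by move=> k; exact: (fY k).1.
  congr (_ + _); apply: eq_bigr => k _; rewrite -pJ //; congr (_ *: _).
  exact: (pD X Z _ vX vZ (vJY k)).
- by apply: tS => k; exact: (fY k).1.
- exact: tS.
Qed.

End pullback.

(** * Metric identities *)

Section metric.
Context {R : realType} {n : nat} {M : manifold R n} {g : tbilin R M}.
Hypothesis rg : semi_riemannian g.

Lemma metric0 p w : tangent p w -> g p 0 w = 0.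
Proof.
move=> tw; have := metric_lin rg (-1) (tangent0 p) (tangent0 p) tw.
by rewrite scaler0 addr0 mulN1r addNr.
Qed.

Lemma metricZ p k u w : tangent p u -> tangent p w -> g p (k *: u) w = k * g p u w.
Proof.
move=> tu tw; have := metric_lin rg k tu (tangent0 p) tw.
by rewrite addr0 metric0 // addr0.
Qed.

Lemma metricN p u w : tangent p u -> tangent p w -> g p (- u) w = - g p u w.
Proof. by move=> tu tw; rewrite -scaleN1r metricZ // mulN1r. Qed.

Lemma metricB p u v w : tangent p u -> tangent p v -> tangent p w ->
  g p (u - v) w = g p u w - g p v w.
Proof.
move=> tu tv tw; have := metric_lin rg (-1) tv tu tw.
by rewrite scaleN1r addrC mulN1r [- _ + _]addrC.
Qed.

Lemma metricNr p u w : tangent p u -> tangent p w -> g p u (- w) = - g p u w.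
Proof.
move=> tu tw; rewrite (Defs.metric_sym rg tu (tangentN tw)) metricN //.
by rewrite (Defs.metric_sym rg tw tu).
Qed.

End metric.

(** * Parallelism of the dual complex structure *)

Section kaehler.
Context {R : realType} {n : nat} {M : manifold R n} {g : tbilin R M}.
Context {J Js : tendo R M} {nabla nablas : conn R M}.

Lemma hermite_adjoint : hermite_like g J Js nabla nablas ->
  forall p u v, tangent p u -> tangent p v -> g p (J p u) v = - g p u (Js p v).
Proof.
move=> H p u v /tangent_extension[X vX <-] /tangent_extension[Y vY <-].
exact: (hl_JJs H).
Qed.

(** Differentiate g(JW, Y) = -g(W, J*Y) along X by duality on both sides. Since J is parallel, the
    terms with the derivative of W cancel, so the defect of J* is orthogonal to every W and vanishes
    by nondegeneracy. *)
Lemma kaehler_dual_parallel : kaehler_like g J Js nabla nablas ->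
  forall X Y, vector_field X -> vector_field Y -> forall p,
  nablas X (fun q => Js q (Y q)) p = Js p (nablas X Y p).
Proof.
move=> [H PJ] X Y vX vY p; have rg := hl_metric H; have adj := hermite_adjoint H.
have [eJ _] := hl_J H; have [eJs _] := hl_Js H.
have vJsY := endo_smooth eJs vY.
have t1 := (conn_field (hl_dual_conn H) vX vJsY).1 p.
have tDsY := (conn_field (hl_dual_conn H) vX vY).1 p.
have t2 := endo_tangent eJs tDsY.
apply/eqP; rewrite -subr_eq0; apply/eqP.
apply: (metric_nondegenerate rg) (tangentD t1 (tangentN t2)) _.
move=> w tw; have [W vW Wp] := tangent_extension tw.
have vJW := endo_smooth eJ vW.
rewrite (metricB rg) // (Defs.metric_sym rg t1 tw) (Defs.metric_sym rg t2 tw) -Wp.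
have tDW := (conn_field (hl_conn H) vX vW).1 p.
have E1 := hl_dual H vW vJsY vX p.
have E2 := hl_dual H vJW vY vX p.
move: E2; rewrite PJ // (adj p) //; last exact: vY.1.
rewrite (adj p (W p)) //; last exact: vW.1.
have -> : (fun q => g q (J q (W q)) (Y q)) = fun q => - g q (W q) (Js q (Y q)).
  by apply/funext => q; rewrite adj //; [exact: vW.1|exact: vY.1].
rewrite (tangent_opp (vX.1 p)) ?E1; last exact: (metric_smooth rg vW vJsY).
set a := g p _ _; set c := g p _ _; set d := g p _ _ => E2.
lra.
Qed.

End kaehler.

(** * Hopf hypersurfaces and the dual derivative of [xis] *)

Section hypersurface.
Context {R : realType} {n : nat} {Mt : manifold R n.+1} {gt : tbilin R Mt}.
Context {J Js : tendo R Mt} {nablat nablats : conn R Mt} {M : manifold R n}.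
Context {i : M -> Mt} {N : M -> tvec R Mt} {xi xis : tfield R M}.
Hypothesis hK : kaehler_like gt J Js nablat nablats.
Hypothesis hM : tangential_hypersurface i gt J Js N xi xis.

(** Adjointness gives g(JN, J*N) = -g(N, J*J*N), and J* squares to -I. Hence the factor eps has
    absolute value 1. *)
Lemma induced_metric_xi p :
  induced_metric i gt p (xi p) (xis p) = gt (i p) (N p) (N p).
Proof.
have [H _] := hK; have rg := hl_metric H; have tN := (th_N hM).1 p.
have [[eJ _] [eJs JsK]] := (hl_J H, hl_Js H).
have tJN := endo_tangent eJ tN; have tJsN := endo_tangent eJs tN.
rewrite /induced_metric (th_xiE hM) (th_xisE hM) (metricN rg) //;
  last exact: tangentN.
rewrite (metricNr rg) // opprK (hermite_adjoint H) // JsK //.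
by rewrite (metricNr rg) // opprK.
Qed.

(** A zero of [xis] would make eps vanish there, against [th_unit]. *)
Lemma xis_neq0 p : xis p <> 0.
Proof.
have [H _] := hK; have rg := hl_metric H; have tN := (th_N hM).1 p.
move=> x0; have := th_unit hM p; rewrite -induced_metric_xi x0 /induced_metric.
rewrite (_ : dmap i 0 = 0); last by apply/funext => h; rewrite /dmap; case: ifP.
have t1 := tangent_dmap (th_smooth hM) ((th_xi hM).1 p).
rewrite (Defs.metric_sym rg t1 (tangent0 _)) (metric0 rg) // normr0 => /eqP.
by rewrite eq_sym oner_eq0.
Qed.

(* Covariant differentiation of [i_* xis = - Js N]: the normal part of the
   Weingarten formula is rotated by [Js] into a multiple of [xis]. *)
Lemma hopf_dual_derivative (Dt Dts : conn_op R M Mt) (nabla nablas : conn R M)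
    (A As : tendo R M) (theta : tform R M) :
  pullback_connection i nablats Dts ->
  gauss_weingarten i gt Dt Dts N xi xis nabla nablas A As theta ->
  hopf A As xi xis -> forall p,
  nablas xis xis p =
    - (induced_metric i gt p (xi p) (xis p) * theta p (xis p)) *: xis p.
Proof.
move=> hDts hGW [rho [rhos [_ _ _ Axis]]] p.
have [H _] := hK; have rg := hl_metric H; have fN := th_N hM.
have tN := fN.1 p; have [eJs JsK] := hl_Js H.
have si := th_smooth hM; have vxis := th_xis hM; have txis := vxis.1 p.
have tJsN := endo_tangent eJs tN.
have fxis := field_along_dmap si vxis.
have fJsN : field_along i (fun q => Js (i q) (N q)).
  rewrite (_ : (fun _ => _) = fun q => -1 *: dmap i (xis q)).
    by apply: field_alongZ => //; exact: smooth_fun_cst.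
  by apply/funext => q; rewrite (th_xisE hM) scaleN1r opprK.
set e := induced_metric i gt p (xi p) (xis p); set t := theta p (xis p).
have dmapZ k (u : tvec R M) : dmap i (k *: u) = k *: dmap i u.
  by apply/funext => h; rewrite /dmap !fctE; case: ifP => //; rewrite scaler0.
have dmapD (u v : tvec R M) : dmap i (u + v) = dmap i u + dmap i v.
  by apply/funext => h; rewrite /dmap !fctE; case: ifP => //; rewrite addr0.
have par := pullback_parallel si hDts (hl_dual_conn H) eJs
  (kaehler_dual_parallel hK) vxis fN fJsN p.
have DN : Dts xis N p = rhos p *: Js (i p) (N p) - (e * t) *: N p.
  rewrite (gw_dual_weingarten hGW) // Axis dmapZ (th_xisE hM).
  by rewrite scalerN opprK.
have DJ : Dts xis (fun q => dmap i (xis q)) p =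
    rhos p *: N p - (e * t) *: dmap i (xis p).
  (* The sign in [xis] = -J*N is entered as a constant function, whose derivative drops out of the
     Leibniz rule. *)
  rewrite (_ : (fun q => _) = fun q => -1 *: Js (i q) (N q)); last first.
    by apply/funext => q; rewrite (th_xisE hM) scaleN1r.
  rewrite (conn_leibniz hDts.1 (smooth_fun_cst (-1)) vxis fJsN) par.
  rewrite (tangent_cst _ txis) scale0r add0r DN scaleN1r (th_xisE hM).
  rewrite -scaleNr (endo_lin eJs) //; last exact: tangentZ.
  by rewrite (endoZ eJs) // JsK // !scaleNr !scalerN opprD !opprK.
have tD := (conn_field (gw_dual_conn hGW) vxis vxis).1 p.
have := gw_dual_gauss hGW vxis vxis p.
rewrite DJ; set k := _ * induced_metric _ _ _ _ _ => E.
(* Once the normal term of the Gauss formula is moved across, the left side is tangent to [M] and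
   the right side is a multiple of [N]. *)
have {}E : dmap i (nablas xis xis p + (e * t) *: xis p) = (rhos p - k) *: N p.
  rewrite dmapD dmapZ scalerBl.
  by apply: (addIr (k *: N p)); rewrite addrAC -E !addrNK.
(* A tangent vector whose image is a multiple of [N] is orthogonal to all tangent vectors, so the
   nondegenerate induced metric forces it to be 0. *)
apply/eqP; rewrite scaleNr -addr_eq0; apply/eqP.
apply: (th_nondegenerate hM) (tangentD tD (tangentZ _ txis)) _ => u tu.
have tiu := tangent_dmap si tu.
by rewrite /induced_metric E (metricZ rg) // (th_normal hM) // mulr0.
Qed.

End hypersurface.

Theorem theorem3p10 (R : realType) (n : nat)
    (Mt : manifold R n.+1) (gt : tbilin R Mt) (J Js : tendo R Mt)
    (nablat nablats : conn R Mt)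
    (M : manifold R n) (i : M -> Mt)
    (N : M -> tvec R Mt) (xi xis : tfield R M)
    (Dt Dts : conn_op R M Mt)
    (nabla nablas : conn R M) (A As : tendo R M) (theta : tform R M)
    (hK : kaehler_like gt J Js nablat nablats)
    (hM : tangential_hypersurface i gt J Js N xi xis)
    (hDt : pullback_connection i nablat Dt)
    (hDts : pullback_connection i nablats Dts)
    (hGW : gauss_weingarten i gt Dt Dts N xi xis nabla nablas A As theta)
    (hHopf : hopf A As xi xis) :
  unit_geodesic nablas xis <-> forall p : M, theta p (xis p) = 0.
Proof.
have hD := hopf_dual_derivative hK hM hDts hGW hHopf.
split=> [geo p|th0 p]; last by rewrite hD th0 mulr0 oppr0.
have /eqP := geo p; rewrite hD scale0r scaler_eq0 oppr_eq0 mulf_eq0.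
have e0 : gt (i p) (N p) (N p) != 0.
  by rewrite -normr_eq0 (th_unit hM) oner_eq0.
(* With eps nonzero, the vanishing multiple of [xis p] leaves either theta(xis) = 0 or [xis p] = 0,
   and the latter is excluded. *)
rewrite (induced_metric_xi hK hM) (negbTE e0) /= => /orP[/eqP //|/eqP x0].
by case: (xis_neq0 hK hM x0).
Qed.
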